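(* Let $0<\mu\le L$, $\kappa:=L/\mu$, and let $f:\mathbb{R}^{d_x}\times\mathbb{R}^{d_y}\to\mathbb{R}$ be an $L$-smooth, $\mu$-strongly-convex-strongly-concave function with saddle point $z^*=(x^*,y^* )$. Let $T\ge1$ be an integer, $0<h\le\frac{1}{3L}$, and $z_0=(x_0,y_0)\in\mathbb{R}^{d_x}\times\mathbb{R}^{d_y}$. Then the iterates $z_t=(x_t,y_t)$ of GDA started at $z_0$ and using the randomized slingshot stepsize schedule with parameter $h$ (defined in the context) satisfy $$\mathbb{E}\left[\|z_{2T}-z^*\|^2\right]\le(1-h\mu)^T\,\|z_0-z^*\|^2,$$ where the expectation is over the randomness of the stepsize schedule. In particular, setting $h=\frac{1}{3L}$, one has $\mathbb{E}\left[\|z_{2T}-z^*\|^2\right]\le\varepsilon$ after $O\!\left(\kappa\log\frac{\|z_0-z^*\|^2}{\varepsilon}\right)$ iterations.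
   Context: $f$ is $L$-smooth if it is differentiable and $\nabla f$ is $L$-Lipschitz (in the Euclidean norm $\|\cdot\|$). A differentiable function $g$ is $\mu$-strongly convex if $g(u)\ge g(v)+\langle\nabla g(v),u-v\rangle+\frac{\mu}{2}\|u-v\|^2$ for all $u,v$; $f(x,y)$ is $\mu$-strongly-convex-strongly-concave if $f(\cdot,y)$ and $-f(x,\cdot)$ are $\mu$-strongly convex for every $y$ and every $x$. A saddle point is a point $(x^*,y^* )$ with $f(x^*,y)\le f(x^*,y^* )\le f(x,y^* )$ for all $x,y$. GDA with stepsizes $\alpha_t,\beta_t\in\mathbb{R}$ is the iteration $x_{t+1}=x_t-\alpha_t\nabla_x f(x_t,y_t)$, $y_{t+1}=y_t+\beta_t\nabla_y f(x_t,y_t)$. Randomized slingshot stepsize schedule with parameter $h$: independently for each $t=0,\dots,T-1$, choose the stepsizes in iterations $2t$ and $2t+1$ as follows. With probability $1/2$, $$\alpha_{2t}=-\beta_{2t}=\beta_{2t+1}=h\ \text{ and }\ \alpha_{2t+1}=0,$$ and otherwise $$-\alpha_{2t}=\beta_{2t}=\alpha_{2t+1}=h\ \text{ and }\ \beta_{2t+1}=0.$$ In the $O(\cdot)$ statement, the constant is universal and $\varepsilon$ is a target accuracy bounded away from the initial error (e.g. $0<\varepsilon\le\frac12\|z_0-z^*\|^2$). *)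

(* Defs.v *)
From HB Require Import structures.
From mathcomp Require Import all_boot all_order all_algebra.
From mathcomp Require Import all_classical all_reals all_analysis.

Set Implicit Arguments.
Unset Strict Implicit.
Unset Printing Implicit Defensive.

Import Order.TTheory GRing.Theory Num.Theory.
Import numFieldNormedType.Exports.

Local Open Scope classical_set_scope.
Local Open Scope ring_scope.

Definition dotv {R : realType} {n : nat} (u v : 'rV[R]_n) : R :=
  \sum_(i < n) u 0 i * v 0 i.

(* The norm that the library puts on 'rV[R]_n and on products is the sup norm,
   so the Euclidean norms have to be introduced separately; both norms induce
   the same topology, hence the same notion of differentiability. *)
Definition enorm {R : realType} {n : nat} (u : 'rV[R]_n) : R :=
  Num.sqrt (dotv u u).

Definition enorm2 {R : realType} {dx dy : nat} (z : 'rV[R]_dx * 'rV[R]_dy) : R :=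
  Num.sqrt (enorm z.1 ^+ 2 + enorm z.2 ^+ 2).

Definition grad {R : realType} {n : nat} (g : 'rV[R]_n -> R) (v : 'rV[R]_n) :
  'rV[R]_n := \row_(i < n) 'D_(delta_mx 0 i) g v.

Definition grad_x {R : realType} {dx dy : nat}
    (f : 'rV[R]_dx * 'rV[R]_dy -> R) (z : 'rV[R]_dx * 'rV[R]_dy) : 'rV[R]_dx :=
  grad (fun x => f (x, z.2)) z.1.

Definition grad_y {R : realType} {dx dy : nat}
    (f : 'rV[R]_dx * 'rV[R]_dy -> R) (z : 'rV[R]_dx * 'rV[R]_dy) : 'rV[R]_dy :=
  grad (fun y => f (z.1, y)) z.2.

Definition grad_xy {R : realType} {dx dy : nat}
    (f : 'rV[R]_dx * 'rV[R]_dy -> R) (z : 'rV[R]_dx * 'rV[R]_dy) :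
    'rV[R]_dx * 'rV[R]_dy :=
  (grad_x f z, grad_y f z).

(* Differentiability is joint (Frechet) differentiability in (x, y). *)
Definition smooth {R : realType} {dx dy : nat} (L : R)
    (f : 'rV[R]_dx * 'rV[R]_dy -> R) : Prop :=
  (forall z, differentiable f z) /\
  (forall z w, enorm2 (grad_xy f z - grad_xy f w) <= L * enorm2 (z - w)).

Definition strongly_convex {R : realType} {n : nat} (mu : R)
    (g : 'rV[R]_n -> R) : Prop :=
  (forall v, differentiable g v) /\
  (forall u v,
     g v + dotv (grad g v) (u - v) + mu / 2 * enorm (u - v) ^+ 2 <= g u).

Definition strongly_convex_concave {R : realType} {dx dy : nat} (mu : R)
    (f : 'rV[R]_dx * 'rV[R]_dy -> R) : Prop :=
  (forall y, strongly_convex mu (fun x => f (x, y))) /\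
  (forall x, strongly_convex mu (fun y => - f (x, y))).

Definition saddle_point {R : realType} {dx dy : nat}
    (f : 'rV[R]_dx * 'rV[R]_dy -> R) (z : 'rV[R]_dx * 'rV[R]_dy) : Prop :=
  forall x y, f (z.1, y) <= f z /\ f z <= f (x, z.2).

Fixpoint gda {R : realType} {dx dy : nat} (f : 'rV[R]_dx * 'rV[R]_dy -> R)
    (alpha beta : nat -> R) (z0 : 'rV[R]_dx * 'rV[R]_dy) (t : nat) :
    'rV[R]_dx * 'rV[R]_dy :=
  match t with
  | 0%N => z0
  | t'.+1 =>
      let z := gda f alpha beta z0 t' in
      (z.1 - alpha t' *: grad_x f z, z.2 + beta t' *: grad_y f z)
  end.

Definition independent_events {R : realType} {d : measure_display}
    {Omega : measurableType d} (P : probability Omega R) {I : finType}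
    (A : I -> set Omega) : Prop :=
  forall J : {set I},
    P (\bigcap_(j in [set` J]) A j) = (\prod_(j in J) fine (P (A j)))%:E.

(* [coin t] is the event that the first alternative is chosen in iterations
   2t and 2t+1; alpha and beta are unconstrained from iteration 2T on. *)
Definition randomized_slingshot {R : realType} {d : measure_display}
    {Omega : measurableType d} (P : probability Omega R) (T : nat) (h : R)
    (alpha beta : nat -> Omega -> R) : Prop :=
  exists coin : 'I_T -> set Omega,
    [/\ forall t, measurable (coin t),
        forall t, P (coin t) = (1 / 2)%:E,
        independent_events P coin,
        forall t w, coin t w ->
          [/\ alpha (2 * t)%N w = h, beta (2 * t)%N w = - h,
              beta (2 * t).+1 w = h & alpha (2 * t).+1 w = 0]
      & forall t w, ~ coin t w ->
          [/\ alpha (2 * t)%N w = - h, beta (2 * t)%N w = h,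
              alpha (2 * t).+1 w = h & beta (2 * t).+1 w = 0]].

(* The integrand depends on finitely many events, so it is a simple function
   and the expectation is a genuine finite one. *)
Definition expected_sq_error {R : realType} {d : measure_display}
    {Omega : measurableType d} (P : probability Omega R) {dx dy : nat}
    (f : 'rV[R]_dx * 'rV[R]_dy -> R) (alpha beta : nat -> Omega -> R)
    (z0 zstar : 'rV[R]_dx * 'rV[R]_dy) (t : nat) : \bar R :=
  ('E_P[(fun w => enorm2 (gda f (alpha ^~ w) (beta ^~ w) z0 t - zstar) ^+ 2)%R])%E.

(* Main.v *)
Require Import Defs.
From HB Require Import structures.
From mathcomp Require Import all_boot all_order all_algebra.
From mathcomp Require Import all_classical all_reals all_analysis.
From mathcomp Require Import measurable_realfun.
From mathcomp Require Import ring lra.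

Set Implicit Arguments.
Unset Strict Implicit.
Unset Printing Implicit Defensive.

Import Order.TTheory GRing.Theory Num.Theory.
Import numFieldNormedType.Exports.

Local Open Scope classical_set_scope.
Local Open Scope ring_scope.

(** Write [g = (a, b)] for the gradient of [f] at the current point [z]. A
    slingshot stage moves to [z - h g] and then corrects [y] with the gradient
    found there, or moves to [z + h g] and then corrects [x]. Each alternative
    contains a step in the wrong direction, but in the average of the two
    squared errors the first-order terms add up to the inner products of the
    error in [x] with the [x]-gradient at [z + h g] and of the error in [y]
    with the [y]-gradient at [z - h g]. Strong convexity-concavity turns these
    into the difference [f (z + h g) - f (z - h g)], which is about
    [2 h |g|^2], plus a gain proportional to [mu]. The difference must pay for
    the second-order terms. The descent lemma alone is too weak for that when
    [h = 1 / (3 L)]; the two-point inequality [smooth_interpolation], which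
    also counts the variation of the gradient, is strong enough, and the
    balance is a sum of four squares ([slingshot_energy]). This gives a
    contraction by [1 - h mu] in average over the coin of each stage
    ([slingshot_stage_contraction]).

    For the whole schedule, independence makes all patterns of coin results
    equally likely ([fair_pattern_probability]); the expected error is then a
    finite average over patterns, which an induction on the number of stages
    bounds ([sum_foldl_le]). The complexity estimate is the usual passage from
    a geometric rate to a logarithmic number of stages ([geometric_decay]). *)

(** * Euclidean inner products *)

Section InnerProduct.
Context {R : realType} {n : nat}.
Implicit Types (u v w : 'rV[R]_n) (c : R).

Lemma dotvC u v : dotv u v = dotv v u.
Proof. by apply: eq_bigr => i _; rewrite mulrC. Qed.

Lemma dotvDl u v w : dotv (u + v) w = dotv u w + dotv v w.
Proof. by rewrite -big_split; apply: eq_bigr => i _; rewrite mxE mulrDl. Qed.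

Lemma dotvZl c u v : dotv (c *: u) v = c * dotv u v.
Proof. by rewrite [RHS]mulr_sumr; apply: eq_bigr => i _; rewrite mxE mulrA. Qed.

Lemma dotvDr u v w : dotv u (v + w) = dotv u v + dotv u w.
Proof. by rewrite !(dotvC u) dotvDl. Qed.

Lemma dotvZr c u v : dotv u (c *: v) = c * dotv u v.
Proof. by rewrite !(dotvC u) dotvZl. Qed.

Lemma dotvNl u v : dotv (- u) v = - dotv u v.
Proof. by rewrite -scaleN1r dotvZl mulN1r. Qed.

Lemma dotvNr u v : dotv u (- v) = - dotv u v.
Proof. by rewrite !(dotvC u) dotvNl. Qed.

Lemma dotvNN u v : dotv (- u) (- v) = dotv u v.
Proof. by rewrite dotvNl dotvNr opprK. Qed.

Lemma dotv0l u : dotv 0 u = 0.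
Proof. by rewrite -(scale0r 0) dotvZl mul0r. Qed.

Lemma dotv0r u : dotv u 0 = 0.
Proof. by rewrite dotvC dotv0l. Qed.

Definition dotvE := (dotvDl, dotvDr, dotvNl, dotvNr, dotvZl, dotvZr).

Lemma dotv_ge0 u : 0 <= dotv u u.
Proof. by apply: sumr_ge0 => i _; rewrite -expr2 sqr_ge0. Qed.

Lemma dotv_eq0 u : (dotv u u == 0) = (u == 0).
Proof.
apply/eqP/eqP => [/eqP|->]; last by rewrite dotv0l.
rewrite psumr_eq0 => [/allP u0|i _]; last by rewrite -expr2 sqr_ge0.
apply/rowP => i; apply/eqP; rewrite mxE -sqrf_eq0 expr2.
exact: u0 (mem_index_enum i).
Qed.

Lemma enorm_sq u : enorm u ^+ 2 = dotv u u.
Proof. by rewrite sqr_sqrtr ?dotv_ge0. Qed.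

End InnerProduct.

Section PairInnerProduct.
Context {R : realType} {dx dy : nat}.
Local Notation Z := ('rV[R]_dx * 'rV[R]_dy)%type.
Implicit Types (u v w z : Z) (c : R).

Definition dot2 u v : R := dotv u.1 v.1 + dotv u.2 v.2.

Lemma dot2C u v : dot2 u v = dot2 v u.
Proof. by rewrite /dot2 dotvC (dotvC u.2). Qed.

Lemma dot2Dl u v w : dot2 (u + v) w = dot2 u w + dot2 v w.
Proof. by rewrite /dot2 !dotvE addrACA. Qed.

Lemma dot2Zl c u v : dot2 (c *: u) v = c * dot2 u v.
Proof. by rewrite /dot2 !dotvE mulrDr. Qed.

Lemma dot2Dr u v w : dot2 u (v + w) = dot2 u v + dot2 u w.
Proof. by rewrite !(dot2C u) dot2Dl. Qed.

Lemma dot2Zr c u v : dot2 u (c *: v) = c * dot2 u v.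
Proof. by rewrite !(dot2C u) dot2Zl. Qed.

Lemma dot2Nl u v : dot2 (- u) v = - dot2 u v.
Proof. by rewrite -scaleN1r dot2Zl mulN1r. Qed.

Lemma dot2Nr u v : dot2 u (- v) = - dot2 u v.
Proof. by rewrite !(dot2C u) dot2Nl. Qed.

Lemma dot2NN u v : dot2 (- u) (- v) = dot2 u v.
Proof. by rewrite dot2Nl dot2Nr opprK. Qed.

Definition dot2E := (dot2Dl, dot2Dr, dot2Nl, dot2Nr, dot2Zl, dot2Zr).

Lemma dot2_ge0 u : 0 <= dot2 u u.
Proof. by rewrite addr_ge0 ?dotv_ge0. Qed.

Lemma enorm2_sq u : enorm2 u ^+ 2 = dot2 u u.
Proof. by rewrite sqr_sqrtr ?addr_ge0 ?sqr_ge0// !enorm_sq. Qed.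

End PairInnerProduct.

(** * Gradients and directional derivatives *)

(** Differentiability is asked of the opposite function because that is what
    strong concavity provides. *)
Lemma gradN (R : realType) (n : nat) (g : 'rV[R]_n -> R) v :
  differentiable (fun x => - g x) v -> grad (fun x => - g x) v = - grad g v.
Proof.
move=> dg; apply/rowP => i; rewrite !mxE; apply: oppr_inj; rewrite opprK.
rewrite -deriveN; last exact: diff_derivable.
suff -> : (- (fun x => - g x)) = g by [].
by apply/funext => x; rewrite !opprfctE opprK.
Qed.

Section Smooth.
Context {R : realType} {dx dy : nat}.
Local Notation Z := ('rV[R]_dx * 'rV[R]_dy)%type.
Implicit Types (f : Z -> R) (u v w z d : Z).

Lemma pairD (x x' : 'rV[R]_dx) (y y' : 'rV[R]_dy) :
  (x, y) + (x', y') = (x + x', y + y') :> Z.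
Proof. by []. Qed.

Lemma pairZ c (x : 'rV[R]_dx) (y : 'rV[R]_dy) :
  c *: (x, y) = (c *: x, c *: y) :> Z.
Proof. by []. Qed.

Lemma derive_grad_x f z i :
  'D_(delta_mx 0 i) (fun x => f (x, z.2)) z.1 = 'D_(delta_mx 0 i, 0) f z.
Proof.
case: z => x y; rewrite /derive /=; do 2 f_equal; apply/funext => s /=.
by rewrite [s *: (_, _) + _](pairD _ _ _ _) ?scaler0 ?add0r.
Qed.

Lemma derive_grad_y f z i :
  'D_(delta_mx 0 i) (fun y => f (z.1, y)) z.2 = 'D_(0, delta_mx 0 i) f z.
Proof.
case: z => x y; rewrite /derive /=; do 2 f_equal; apply/funext => s /=.
by rewrite [s *: (_, _) + _](pairD _ _ _ _) ?scaler0 ?add0r.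
Qed.

Lemma pair_sum_delta d :
  d = \sum_i d.1 0 i *: (delta_mx 0 i, 0) + \sum_j d.2 0 j *: (0, delta_mx 0 j).
Proof.
case: d => x y /=; rewrite [LHS](_ : _ = (x, 0) + (0, y)); last first.
  by rewrite pairD addr0 add0r.
rewrite {1}(row_sum_delta x) {1}(row_sum_delta y).
congr (_ + _).
  rewrite (big_morph (fun u : 'rV[R]_dx => (u, 0) : Z) (id1 := 0) (op1 := +%R))//.
    by apply: eq_bigr => i _; rewrite pairZ scaler0.
  by move=> u v; rewrite pairD addr0.
rewrite (big_morph (fun u : 'rV[R]_dy => (0, u) : Z) (id1 := 0) (op1 := +%R))//.
  by apply: eq_bigr => i _; rewrite pairZ scaler0.
by move=> u v; rewrite pairD addr0.
Qed.

(** The gradient is assembled from partial derivatives of the sections of [f];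
    joint differentiability makes the differential linear, so those partial
    derivatives determine the derivative in every direction. *)
Lemma derive_dot2 f z d :
  differentiable f z -> 'D_d f z = dot2 (grad_xy f z) d.
Proof.
move=> df; rewrite deriveE// {1}(pair_sum_delta d) linearD !linear_sum /dot2.
congr (_ + _); apply: eq_bigr => i _; rewrite linearZ/= mxE mulrC -deriveE//.
  by rewrite -derive_grad_x.
by rewrite -derive_grad_y.
Qed.

Lemma is_derive_segment f z d (s : R) :
  (forall z, differentiable f z) ->
  is_derive s 1 (fun t => f (z + t *: d)) (dot2 (grad_xy f (z + s *: d)) d).
Proof.
move=> df; rewrite -derive_dot2//.
have E : (fun h : R => h^-1 *: (f (z + (h *: 1 + s) *: d) - f (z + s *: d)))
       = (fun h : R => h^-1 *: (f (h *: d + (z + s *: d)) - f (z + s *: d))).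
  apply/funext => h; do 3 f_equal.
  by rewrite scalerDl addrCA [h *: 1]mulr1.
split; last by rewrite /derive /= /shift/= E.
have := @diff_derivable _ _ _ f (z + s *: d) d (df _).
by rewrite /derivable /= /shift /= E.
Qed.

(** * Quadratic bounds for smooth functions *)

(** The descent lemma: along the segment from [z] to [w], the derivative of
    [f] minus the proposed upper bound is nonpositive, because the gradient is
    [L]-Lipschitz; the mean value theorem concludes. *)
Lemma smooth_upper (L : R) f z w : 0 < L -> smooth L f ->
  f w <= f z + dot2 (grad_xy f z) (w - z) + L / 2 * dot2 (w - z) (w - z).
Proof.
move=> L0 [df lip]; have -> : w = z + (w - z) by rewrite addrC subrK.
move: (w - z) => d; have -> : z + d - z = d by rewrite addrC addKr.
set g := grad_xy f z.
pose phi t := f (z + t *: d) - (t * dot2 g d + t ^+ 2 * (L / 2 * dot2 d d)).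
pose dphi t := dot2 (grad_xy f (z + t *: d) - g) d - t * (L * dot2 d d).
have dphiP (t : R) : is_derive t 1 phi (dphi t).
  have H := is_derive_segment z d t df.
  rewrite /phi; apply: is_derive_eq; rewrite /dphi dot2Dl dot2Nl.
  by rewrite /GRing.scale/=; field.
have cphi : {within `[0, 1], continuous phi}.
  by apply: derivable_within_continuous => s _; have [] := dphiP s.
have [t /[!in_itv]/= /andP[t0 t1] E] :=
    MVT ltr01 (fun t _ => dphiP t) cphi.
have : dphi t <= 0.
  (* Expanding the square of D - L t d bounds the inner product of D and d
     by L t times the square of d, as the Cauchy-Schwarz inequality would. *)
  have := lip (z + t *: d) z.
  have -> : z + t *: d - z = t *: d by rewrite addrC addKr.
  rewrite -/g /dphi; move: (_ - g) => D lipD.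
  have {lipD} : dot2 D D <= (L * t) ^+ 2 * dot2 d d.
    rewrite -enorm2_sq (_ : _ * dot2 d d = (L * enorm2 (t *: d)) ^+ 2).
      by rewrite ler_sqr ?nnegrE ?mulr_ge0 ?sqrtr_ge0// ltW.
    by rewrite !exprMn enorm2_sq !dot2E; ring.
  have := dot2_ge0 (D - (L * t) *: d).
  have Lt : 0 < L * t by rewrite mulr_gt0.
  rewrite !dot2E (dot2C d D) => A B.
  rewrite -(ler_pM2l Lt); nra.
move: E; rewrite /phi scale1r scale0r addr0; lra.
Qed.

Lemma grad_xyN f z : differentiable f z ->
  grad_xy (fun x => - f x) z = - grad_xy f z.
Proof.
move=> df; congr (_, _); apply/rowP => i; rewrite !mxE.
- rewrite (derive_grad_x (fun x => - f x)) deriveN ?derive_grad_x//.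
  exact: diff_derivable.
- rewrite (derive_grad_y (fun x => - f x)) deriveN ?derive_grad_y//.
  exact: diff_derivable.
Qed.

Lemma smoothN (L : R) f : smooth L f -> smooth L (fun z => - f z).
Proof.
move=> [df lip]; split=> [z|z w]; first exact: differentiableN.
rewrite !grad_xyN// -opprD; have := lip z w.
rewrite /enorm2 /= /enorm !dotvNl !dotvNr !opprK//.
Qed.

Lemma smooth_lower (L : R) f z w : 0 < L -> smooth L f ->
  f z + dot2 (grad_xy f z) (w - z) - L / 2 * dot2 (w - z) (w - z) <= f w.
Proof.
move=> L0 sf; have /= := smooth_upper z w L0 (smoothN sf).
by rewrite grad_xyN ?dot2Nl; [lra|exact: sf.1].
Qed.

(** The sharp two-point inequality for smooth functions, convex or not. For
    every [w], [f w] is bounded below by the quadratic model at [u] and above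
    by the one at [v]; eliminating [f w] bounds [f v] from below, and the [w]
    chosen in the proof makes that bound the largest. The last term, quadratic
    in the variation of the gradient, is what the descent lemma lacks. *)
Lemma smooth_interpolation (L : R) f u v : 0 < L -> smooth L f ->
  f u + dot2 (grad_xy f u + grad_xy f v) (v - u) / 2
      - L / 4 * dot2 (v - u) (v - u)
      + dot2 (grad_xy f v - grad_xy f u) (grad_xy f v - grad_xy f u) / (4 * L)
    <= f v.
Proof.
move=> L0 sf; set a := grad_xy f u; set b := grad_xy f v.
pose e := 2^-1 *: (v - u); pose q := (2 * L)^-1 *: (b - a).
have ee : u + e + e = v.
  have half : 2^-1 + 2^-1 = 1 :> R by field.
  by rewrite -addrA -scalerDl half scale1r addrC subrK.
(* w = (u + v) / 2 - (b - a) / (2 L) is the stationary point of the difference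
   of the two quadratic models. *)
pose w := u + e - q.
have := smooth_lower u w L0 sf; have := smooth_upper v w L0 sf.
rewrite -/a -/b.
have -> : w - u = e - q by rewrite /w -(addrA u) addrC addrK.
have -> : w - v = - (e + q).
  by rewrite -ee /w opprD addrACA subrr add0r [in RHS]addrC opprD.
have -> : v - u = 2 *: e by rewrite scalerA divff ?scale1r.
have -> : b - a = (2 * L) *: q.
  by rewrite scalerA divff ?scale1r// mulf_neq0 ?gt_eqF.
have -> : a = b - (2 * L) *: q.
  by rewrite scalerA divff ?scale1r ?subKr// mulf_neq0 ?gt_eqF.
move: (f w) (f u) (f v) => fw fu fv; clear w ee.
clearbody e q b.
rewrite !dot2E (dot2C q e) (_ : _ / (4 * L) = L * dot2 q q); last first.
  by field; rewrite gt_eqF.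
lra.
Qed.

(** If a partial gradient did not vanish at the saddle point, a gradient step
    of length [1 / L] in that variable alone would violate extremality by the
    descent lemma. *)
Lemma saddle_grad_eq0 (L : R) f zs : 0 < L -> smooth L f ->
  saddle_point f zs -> grad_xy f zs = 0.
Proof.
case: zs => xs ys L0 sf sad; rewrite /grad_xy.
set a := grad_x f _; set b := grad_y f _.
have [L1 L2] : L * L^-1 = 1 /\ 0 < L^-1 by rewrite divff ?gt_eqF ?invr_gt0.
have pairB x y : (x, y) - (xs, ys) = (x - xs, y - ys) :> Z by [].
suff [a0 b0] : dotv a a <= 0 /\ dotv b b <= 0.
  suff [-> ->] : a = 0 /\ b = 0 by [].
  by split; apply/eqP; rewrite -dotv_eq0 eq_le ?a0 ?b0 dotv_ge0.
split.
- have := smooth_upper (xs, ys) (xs - L^-1 *: a, ys) L0 sf.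
  have [_] := sad (xs - L^-1 *: a) ys.
  rewrite /= pairB /dot2/= -/a -/b [xs - _]addrC addrK subrr !dotv0r.
  rewrite !dotvE; move: (f _) (f _) => f1 f2 A B.
  have : L^-1 / 2 * dotv a a <= 0.
    have E : L / 2 * (L^-1 * (L^-1 * dotv a a)) = L^-1 / 2 * dotv a a.
      by rewrite -[in RHS](mul1r L^-1) -L1; ring.
    lra.
  by rewrite pmulr_rle0// divr_gt0.
- have := smooth_lower (xs, ys) (xs, ys + L^-1 *: b) L0 sf.
  have [+ _] := sad xs (ys + L^-1 *: b).
  rewrite /= pairB /dot2/= -/a -/b [ys + _]addrC addrK subrr !dotv0r.
  rewrite !dotvE; move: (f _) (f _) => f1 f2 A B.
  have : L^-1 / 2 * dotv b b <= 0.
    have E : L / 2 * (L^-1 * (L^-1 * dotv b b)) = L^-1 / 2 * dotv b b.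
      by rewrite -[in RHS](mul1r L^-1) -L1; ring.
    lra.
  by rewrite pmulr_rle0// divr_gt0.
Qed.

(** * One slingshot stage *)

Definition slingshot_stage f (h : R) (c : bool) z : Z :=
  let g := grad_xy f z in
  if c then let w := z - h *: g in (w.1, w.2 + h *: grad_y f w)
  else let w := z + h *: g in (w.1 - h *: grad_x f w, w.2).

(** The inequality behind the contraction, freed of gradients. Here [(x, y)]
    is the current error, [(a, b)] the gradient at the current point [z], and
    [P], [M] are the variations of the gradient between [z] and the two
    slingshot points [z + h (a, b)] and [z - h (a, b)]. The numbers [fs], [fz],
    [fp], [fm] are the values of [f] at the saddle point, at [z] and at the two
    slingshot points; [fxs] is its value at [z - h (a, b)] with the [y]-part
    moved to the saddle point, [fys] its value at [z + h (a, b)] with the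
    [x]-part moved there.

    The squared errors after the two alternatives involve [x] against the
    [x]-gradient at [z + h (a, b)] and [y] against the [y]-gradient at
    [z - h (a, b)]. Strong
    convexity-concavity bounds these by [- (fp - fm)] plus terms in [mu], and
    the interpolation inequality bounds [fp - fm] from below. After division by
    [2 h ^+ 2], the resulting bound on the terms without [mu] is, at
    [h = 1 / (3 L)], exactly the opposite of
    [1/4 |a - P1|^2 + 1/4 |b - M2|^2 + 3/4 |M1 + a/3|^2 + 3/4 |P2 + b/3|^2].
    A smaller [h] only makes it more negative. *)
Lemma slingshot_energy (mu L h fs fz fp fm fxs fys : R) (x a P1 M1 : 'rV[R]_dx)
    (y b P2 M2 : 'rV[R]_dy) :
  0 < mu -> 0 < L -> 0 < h -> h * L <= 1 / 3 ->
  fp + dotv (a + P1) (- (x + h *: a))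
    + mu / 2 * dotv (x + h *: a) (x + h *: a) <= fys ->
  - fm + dotv (- (b + M2)) (- (y - h *: b))
    + mu / 2 * dotv (y - h *: b) (y - h *: b) <= - fxs ->
  fs + mu / 2 * dotv (x - h *: a) (x - h *: a) <= fxs ->
  - fs + mu / 2 * dotv (y + h *: b) (y + h *: b) <= - fys ->
  fz + dot2 ((a, b) + (a, b) + (P1, P2)) (h *: (a, b)) / 2
    - L / 4 * dot2 (h *: (a, b)) (h *: (a, b))
    + dot2 (P1, P2) (P1, P2) / (4 * L) <= fp ->
  fm + dot2 ((a, b) + (a, b) + (M1, M2)) (h *: (a, b)) / 2
    - L / 4 * dot2 (h *: (a, b)) (h *: (a, b))
    + dot2 (M1, M2) (M1, M2) / (4 * L) <= fz ->
  dotv (x - h *: a) (x - h *: a)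
    + dotv (y + h *: M2) (y + h *: M2)
    + dotv (x - h *: P1) (x - h *: P1)
    + dotv (y + h *: b) (y + h *: b)
  <= 2 * (1 - h * mu) * (dotv x x + dotv y y).
Proof.
move=> mu0 L0 h0 hL F1 F2 F3 F4 F5 F6.
have Linv : 3 / 4 * h <= (4 * L)^-1.
  by rewrite -[leRHS]div1r ler_pdivlMr ?mulr_gt0//; lra.
have KP : 3 / 4 * h * dot2 (P1, P2) (P1, P2) <= dot2 (P1, P2) (P1, P2) / (4 * L).
  by rewrite [leRHS]mulrC ler_wpM2r// dot2_ge0.
have KM : 3 / 4 * h * dot2 (M1, M2) (M1, M2) <= dot2 (M1, M2) (M1, M2) / (4 * L).
  by rewrite [leRHS]mulrC ler_wpM2r// dot2_ge0.
have KL : L * dot2 (h *: (a, b)) (h *: (a, b)) <= h / 3 * dot2 (a, b) (a, b).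
  rewrite dot2Zl dot2Zr !mulrA ler_wpM2r ?dot2_ge0//; nra.
have KF : fp - fm + dotv (a + P1) (- (x + h *: a))
    + dotv (- (b + M2)) (- (y - h *: b))
    + mu / 2 * (dotv (x + h *: a) (x + h *: a) + dotv (y - h *: b) (y - h *: b)
     + dotv (x - h *: a) (x - h *: a) + dotv (y + h *: b) (y + h *: b)) <= 0.
  lra.
have KG : dot2 ((a, b) + (a, b) + (P1, P2)) (h *: (a, b)) / 2
   + dot2 ((a, b) + (a, b) + (M1, M2)) (h *: (a, b)) / 2
   + 3 / 4 * h * (dot2 (P1, P2) (P1, P2) + dot2 (M1, M2) (M1, M2))
   - h / 6 * dot2 (a, b) (a, b) <= fp - fm.
  lra.
have S1 := dotv_ge0 (a - P1).
have S2 := dotv_ge0 (b - M2).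
have S3 := dotv_ge0 (M1 + 3^-1 *: a).
have S4 := dotv_ge0 (P2 + 3^-1 *: b).
have K : 0 <= h * (fp - fm - (dot2 ((a, b) + (a, b) + (P1, P2)) (h *: (a, b)) / 2
   + dot2 ((a, b) + (a, b) + (M1, M2)) (h *: (a, b)) / 2
   + 3 / 4 * h * (dot2 (P1, P2) (P1, P2) + dot2 (M1, M2) (M1, M2))
   - h / 6 * dot2 (a, b) (a, b))).
  by apply: mulr_ge0; [exact: ltW|rewrite subr_ge0].
move: KF; rewrite -oppr_ge0 -(pmulr_rge0 _ h0) => KF.
have {}S1 := mulr_ge0 (sqr_ge0 h) S1; have {}S2 := mulr_ge0 (sqr_ge0 h) S2.
have {}S3 := mulr_ge0 (sqr_ge0 h) S3; have {}S4 := mulr_ge0 (sqr_ge0 h) S4.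
have S5 : 0 <= mu * h ^+ 3 * dot2 (a, b) (a, b).
  by rewrite mulr_ge0 ?dot2_ge0 ?mulr_ge0 ?exprn_ge0 ?(ltW mu0) ?(ltW h0).
clear - K KF S1 S2 S3 S4 S5.
move: K KF S1 S2 S3 S4 S5; rewrite !dot2E /dot2 /= !dotvE.
rewrite (dotvC P1 a) (dotvC P2 b) (dotvC M1 a) (dotvC M2 b).
rewrite (dotvC a x) (dotvC P1 x) (dotvC b y) (dotvC M2 y).
lra.
Qed.

(** The two alternatives of a stage average to a contraction, although a single
    one may increase the error, as it does when [f] is dominated by a bilinear
    coupling of [x] and [y]. *)
Lemma slingshot_stage_contraction (mu L h : R) f zs z :
  0 < mu -> 0 < L -> 0 < h -> h * L <= 1 / 3 ->
  smooth L f -> strongly_convex_concave mu f -> saddle_point f zs ->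
  enorm2 (slingshot_stage f h true z - zs) ^+ 2
    + enorm2 (slingshot_stage f h false z - zs) ^+ 2
  <= 2 * (1 - h * mu) * enorm2 (z - zs) ^+ 2.
Proof.
case: z zs => [x y] [xs ys] mu0 L0 h0 hL sf [cvx ccv] sad.
set zp := (x, y) + h *: grad_xy f (x, y).
set zm := (x, y) - h *: grad_xy f (x, y).
pose a := grad_x f (x, y); pose b := grad_y f (x, y).
pose P1 := grad_x f zp - a; pose P2 := grad_y f zp - b.
pose M1 := grad_x f zm - a; pose M2 := grad_y f zm - b.
have [gx0 gy0] := saddle_grad_eq0 L0 sf sad.
have E1 n (u p w : 'rV[R]_n) : p - (u + w) = - (u - p + w).
  by rewrite addrAC opprB.
have E2 n (u p w : 'rV[R]_n) : u + w - p = u - p + w by rewrite addrAC.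
have EP1 : a + P1 = grad_x f zp by rewrite addrC subrK.
have EM2 : b + M2 = grad_y f zm by rewrite addrC subrK.
have F1 : f zp + dotv (a + P1) (- (x - xs + h *: a))
    + mu / 2 * dotv (x - xs + h *: a) (x - xs + h *: a) <= f (xs, y + h *: b).
  have := (cvx (y + h *: b)).2 xs (x + h *: a).
  by rewrite enorm_sq E1 dotvNN EP1.
have F2 : - f zm + dotv (- (b + M2)) (- (y - ys - h *: b))
    + mu / 2 * dotv (y - ys - h *: b) (y - ys - h *: b) <= - f (x - h *: a, ys).
  have := (ccv (x - h *: a)).2 ys (y - h *: b).
  rewrite gradN; last exact: (ccv _).1.
  by rewrite enorm_sq E1 (dotvNN (y - ys - _)) EM2.
have F3 : f (xs, ys) + mu / 2 * dotv (x - xs - h *: a) (x - xs - h *: a)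
    <= f (x - h *: a, ys).
  have := (cvx ys).2 (x - h *: a) xs.
  by rewrite enorm_sq E2 [grad _ xs]gx0 dotv0l addr0.
have F4 : - f (xs, ys) + mu / 2 * dotv (y - ys + h *: b) (y - ys + h *: b)
    <= - f (xs, y + h *: b).
  have := (ccv xs).2 (y + h *: b) ys.
  rewrite gradN; last exact: (ccv _).1.
  by rewrite enorm_sq E2 [grad _ ys]gy0 oppr0 dotv0l addr0.
have Gp : grad_xy f zp = (a, b) + (P1, P2).
  by rewrite pairD EP1 [b + P2]addrC subrK.
have Gm : grad_xy f zm = (a, b) + (M1, M2).
  by rewrite pairD EM2 [a + M1]addrC subrK.
have Ep : zp - (x, y) = h *: (a, b) by rewrite /zp addrC addKr.
have Em : (x, y) - zm = h *: (a, b) by rewrite /zm subKr.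
have F5 := smooth_interpolation (x, y) zp L0 sf.
have F6 := smooth_interpolation zm (x, y) L0 sf.
rewrite Gp Ep -[grad_xy f (x, y)]/(a, b) addrA in F5.
rewrite [in X in dot2 X X / _]addrC addKr in F5.
rewrite Gm Em -[grad_xy f (x, y)]/(a, b) in F6.
rewrite -[(a, b) - _]opprB dot2NN in F6.
rewrite [_ + (a, b)]addrC addrA [_ + _ - (a, b)]addrC addKr in F6.
have := slingshot_energy mu0 L0 h0 hL F1 F2 F3 F4 F5 F6.
(* Naming the three squared norms keeps the matching of [enorm2_sq] away from
   the gradients inside them. *)
set Et := (X in _ -> X + _ <= _); set Ef := (X in _ -> _ + X <= _).
set Ez := (X in _ -> _ <= _ * X).
have E3 n (u v p w : 'rV[R]_n) : u - v + w - p = u - p + (w - v).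
  by rewrite [RHS]addrA [RHS]addrAC [LHS]addrAC [u - v - p]addrAC.
have -> : Et = dotv (x - xs - h *: a) (x - xs - h *: a) +
               dotv (y - ys + h *: M2) (y - ys + h *: M2).
  have Ey : y - h *: b + h *: grad_y f zm - ys = y - ys + h *: M2.
    by rewrite E3 scalerBr.
  by rewrite [Et]enorm2_sq /dot2 /= E2 Ey.
have -> : Ef = dotv (x - xs - h *: P1) (x - xs - h *: P1) +
               dotv (y - ys + h *: b) (y - ys + h *: b).
  have Ex : x + h *: a - h *: grad_x f zp - xs = x - xs - h *: P1.
    by rewrite [x + _ - _]addrAC E3 scalerBr opprB.
  by rewrite [Ef]enorm2_sq /dot2 /= Ex [y + _ - ys]E2.
have -> : Ez = dotv (x - xs) (x - xs) + dotv (y - ys) (y - ys).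
  by rewrite [Ez]enorm2_sq.
by rewrite addrA.
Qed.
End Smooth.

(** * From stages to iterates *)

Section Stages.
Context {R : realType} {dx dy : nat}.
Local Notation Z := ('rV[R]_dx * 'rV[R]_dy)%type.

Definition slingshot_pattern (h : R) (alpha beta : nat -> R) (c : bool) (t : nat) :=
  if c then [/\ alpha (2 * t)%N = h, beta (2 * t)%N = - h,
                beta (2 * t).+1 = h & alpha (2 * t).+1 = 0]
  else [/\ alpha (2 * t)%N = - h, beta (2 * t)%N = h,
           alpha (2 * t).+1 = h & beta (2 * t).+1 = 0].

Lemma gda_slingshot (f : Z -> R) (h : R) (alpha beta : nat -> R) (z0 : Z) s :
  (forall t, (t < size s)%N -> slingshot_pattern h alpha beta (nth false s t) t) ->
  gda f alpha beta z0 (2 * size s) =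
  foldl (fun z c => slingshot_stage f h c z) z0 s.
Proof.
elim/last_ind: s => [//|s c IH] Hs.
rewrite size_rcons foldl_rcons mulnS /= IH => [|t ts]; last first.
  by have := Hs t; rewrite size_rcons nth_rcons ts ltnS (ltnW ts); exact.
move: (foldl _ z0 s) => z.
have := Hs (size s); rewrite size_rcons nth_rcons ltnn eqxx ltnSn => /(_ isT).
rewrite /slingshot_pattern /slingshot_stage.
case: c {Hs} => -[-> -> -> ->]; rewrite scale0r ?subr0 ?addr0 !scaleNr ?opprK//.
Qed.

End Stages.

Lemma sum_tuple_cons (V : nmodType) (n : nat) (G : seq bool -> V) :
  \sum_(s : n.+1.-tuple bool) G s =
  \sum_(s : n.-tuple bool) (G (true :: s) + G (false :: s)).
Proof.
rewrite (reindex (fun p : bool * n.-tuple bool => cons_tuple p.1 p.2)).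
  rewrite -(pair_bigA _ (fun b (s : n.-tuple bool) => G (b :: s)))/=.
  by rewrite big_bool -big_split.
exists (fun s : n.+1.-tuple bool => (thead s, behead_tuple s)) => [[b s] _|s _] /=.
  by congr (_, _); exact: val_inj.
by rewrite [RHS]tuple_eta; exact: val_inj.
Qed.

(** Conditioning on the first stage: the bound for the remaining stages holds
    from both possible successors, and the one-stage bound adds them up. *)
Lemma sum_foldl_le (R : numDomainType) (Z : Type) (step : Z -> bool -> Z)
    (F : Z -> R) (rho : R) :
  0 <= rho ->
  (forall z, F (step z true) + F (step z false) <= 2 * rho * F z) ->
  forall n z, \sum_(s : n.-tuple bool) F (foldl step z s) <= (2 * rho) ^+ n * F z.
Proof.
move=> rho0 HF; elim=> [|n IH] z.
  rewrite expr0 mul1r (big_pred1 [tuple]) => [//|s].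
  by apply/esym/eqP/val_inj; case: s => [[]].
rewrite (sum_tuple_cons _ (fun s => F (foldl step z s))) big_split/=.
apply: le_trans (lerD (IH _) (IH _)) _.
by rewrite -mulrDr exprSr -mulrA ler_wpM2l// exprn_ge0 ?mulr_ge0.
Qed.

(** * Fair coins *)

Section FairCoins.
Context {R : realType} {d : measure_display} {Omega : measurableType d}
  (P : probability Omega R).

(** Independence is a product rule for the events themselves; complements are
    brought in one at a time by [P (X minus A) = P X - P (X and A)], where both
    probabilities on the right involve one complement fewer. *)
Lemma fair_pattern_probability (I : finType) (A : I -> set Omega) :
  (forall i, measurable (A i)) -> (forall i, P (A i) = (1 / 2)%:E) ->
  independent_events P A ->
  forall S N : {set I}, [disjoint S & N]%bool ->
  P (\bigcap_(i in [set` S]) A i `&` \bigcap_(i in [set` N]) ~` A i) =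
  ((1 / 2) ^+ (#|S| + #|N|))%:E.
Proof.
move=> mA PA indA S N; move E : #|N| => n.
have mcap (f : I -> set Omega) (B : {set I}) : (forall i, measurable (f i)) ->
    measurable (\bigcap_(i in [set` B]) f i).
  by move=> mf; apply: fin_bigcap_measurable => [|i _]; [exact: finite_finset|].
have mAC i : measurable (~` A i) by exact: measurableC.
elim: n => [|n IH] in S N E *.
  move=> _; rewrite (cards0_eq E) [X in _ `&` X](_ : _ = setT); last first.
    by apply/seteqP; split => // w _ i /=; rewrite inE.
  rewrite setIT indA addn0; congr EFin.
  under eq_bigr => i _ do rewrite PA /=.
  by rewrite prodr_const.
move=> SN; have /card_gt0P[i iN] : (0 < #|N|)%N by rewrite E.
have iS : i \notin S by apply/negP => /(disjointFr SN); rewrite iN.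
have EN : #|N :\ i| = n by move: E; rewrite (cardsD1 i) iN => -[].
have D1 : [disjoint S & N :\ i]%bool.
  by apply: disjointWr SN; exact: subD1set.
have D2 : [disjoint i |: S & N :\ i]%bool.
  rewrite disjoint_subset; apply/fintype.subsetP => j; rewrite !inE.
  by case/predU1P => [->|jS]; rewrite ?eqxx// (disjointFr SN jS) andbF.
have H1 := IH _ _ EN D1; have H2 := IH _ _ EN D2.
set X := _ `&` _ in H1; set Y := _ `&` _ in H2.
have XY : X `&` A i = Y.
  apply/seteqP; split => w /=.
    move=> [[wS wN] wi]; split => // j /=; rewrite !inE => /predU1P[->//|].
    exact: wS.
  move=> [wS wN]; split; last by apply: wS; rewrite /= !inE eqxx.
  by split=> // j /= jS; apply: wS; rewrite /= !inE jS orbT.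
have -> : \bigcap_(i in [set` S]) A i `&` \bigcap_(i in [set` N]) ~` A i = X `\` A i.
  apply/seteqP; split => w /=.
    move=> [wS wN]; split; last exact: wN.
    by split=> // j /=; rewrite !inE => /andP[_]; exact: wN.
  move=> [[wS wN] wi]; split => // j /= jN.
  have [->//|ji] := eqVneq j i.
  by apply: wN; rewrite /= !inE ji.
have -> : P (X `\` A i) = (P X - P Y)%E.
  have mX : measurable X by apply: measurableI; exact: mcap.
  rewrite -XY; apply: measureD => //.
  exact: le_lt_trans (probability_le1 P mX) (ltry 1).
rewrite H1 H2 -EFinB; congr EFin; rewrite cardsU1 iS addnS addSn exprS; lra.
Qed.

Lemma expectation_fin (K : finType) (X : Omega -> K) (V : K -> R) :
  (forall k, measurable (X @^-1` [set k])) -> (forall k, 0 <= V k) ->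
  ('E_P[(fun w => V (X w))] = \sum_k (V k)%:E * P (X @^-1` [set k]))%E.
Proof.
move=> mX V0; rewrite unlock.
rewrite (eq_integral (fun w => \sum_k ((V k)%:E * (\1_(X @^-1` [set k]) w)%:E))%E).
  rewrite ge0_integral_sum//=.
  - apply: eq_bigr => k _; rewrite ge0_integralZl//= ?lee_fin//.
    + by rewrite integral_indic// setIT.
    + apply/measurable_EFinP; exact: measurable_indic.
  - by move=> k; apply: measurable_funeM; apply/measurable_EFinP; exact: measurable_indic.
  - by move=> k w _; rewrite mule_ge0// lee_fin.
move=> w _ /=; rewrite (bigD1 (X w))//= big1 ?adde0 => [|k kX].
  by rewrite indicE mem_set// mule1.
by rewrite indicE memNset ?mule0// => /= E; rewrite E eqxx in kX.
Qed.

End FairCoins.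

(** * Convergence *)

(** The iterate depends on the outcome only through the [T] coin results, all
    of whose [2 ^ T] patterns are equally likely, so the expectation is the
    average over patterns bounded by [sum_foldl_le]. *)
Lemma expected_slingshot_error (R : realType) (dx dy : nat) (mu L h : R)
    (f : 'rV[R]_dx * 'rV[R]_dy -> R) (zstar z0 : 'rV[R]_dx * 'rV[R]_dy)
    (T : nat) (d : measure_display) (Omega : measurableType d)
    (P : probability Omega R) (alpha beta : nat -> Omega -> R) :
  0 < mu -> mu <= L -> 0 < h -> h <= 1 / (3 * L) ->
  smooth L f -> strongly_convex_concave mu f -> saddle_point f zstar ->
  randomized_slingshot P T h alpha beta ->
  (expected_sq_error P f alpha beta z0 zstar (2 * T)
     <= ((1 - h * mu) ^+ T * enorm2 (z0 - zstar) ^+ 2)%:E)%E.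
Proof.
move=> mu0 muL h0 hL sf scc sad [coin [mcoin Pcoin indep Hheads Htails]].
have L0 : 0 < L := lt_le_trans mu0 muL.
have {}hL : h * L <= 1 / 3.
  move: hL; rewrite ler_pdivlMr ?mulr_gt0//; lra.
have rho0 : 0 <= 1 - h * mu by nra.
pose X w := [tuple `[< coin i w >] | i < T].
pose F z : R := enorm2 (z - zstar) ^+ 2.
pose V (s : T.-tuple bool) : R :=
  F (foldl (fun z c => slingshot_stage f h c z) z0 s).
have -> : expected_sq_error P f alpha beta z0 zstar (2 * T) =
    'E_P[(fun w => V (X w))]%E.
  congr expectation; apply/funext => w; rewrite /V /F.
  rewrite -(@gda_slingshot _ _ _ f h (alpha ^~ w) (beta ^~ w)).
    by rewrite size_tuple.
  move=> t; rewrite size_tuple => tT.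
  rewrite -[t]/(nat_of_ord (Ordinal tT)) -tnth_nth tnth_mktuple.
  by case: asboolP => [/Hheads|/Htails].
have XE s : X @^-1` [set s] =
    \bigcap_(i in [set` [set i | tnth s i]%SET]) coin i `&`
    \bigcap_(i in [set` ~: [set i | tnth s i]%SET]) ~` coin i.
  apply/seteqP; split => w /=.
    move=> <-; split => i /=; rewrite !inE tnth_mktuple; first by move/asboolP.
    by move/asboolP.
  move=> [ws wn]; apply: eq_from_tnth => i; rewrite tnth_mktuple.
  apply/asboolP/idP => [wi|si]; last by apply: ws; rewrite /= inE.
  by apply/negPn/negP => /negP si; apply: (wn i) => //=; rewrite !inE; apply/negP.
have PX s : P (X @^-1` [set s]) = ((1 / 2) ^+ T)%:E.
  rewrite XE fair_pattern_probability//.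
    by rewrite cardsC card_ord.
  by rewrite -finset.setI_eq0 finset.setICr.
have mX s : measurable (X @^-1` [set s]).
  rewrite XE; apply: measurableI; apply: fin_bigcap_measurable => [|i _].
  - exact: finite_finset.
  - exact: mcoin.
  - exact: finite_finset.
  - exact: measurableC.
rewrite expectation_fin//; last by move=> s; exact: sqr_ge0.
under eq_bigr => s _ do rewrite PX -EFinM.
rewrite sumEFin lee_fin -mulr_suml.
have HF z : F (slingshot_stage f h true z) + F (slingshot_stage f h false z)
    <= 2 * (1 - h * mu) * F z.
  exact: slingshot_stage_contraction z mu0 L0 h0 hL sf scc sad.
have p0 : 0 <= (1 / 2) ^+ T :> R by rewrite exprn_ge0.
have H := sum_foldl_le (step := fun z c => slingshot_stage f h c z) rho0 HF T z0.
apply: le_trans (ler_wpM2r p0 H) _.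
have half : 2 * (1 / 2) = 1 :> R by field.
by rewrite exprMn mulrAC [_ * (1 / 2) ^+ T]mulrAC -exprMn half expr1n mul1r.
Qed.

(** Since [1 - x <= expR (- x)], the first integer [n] above
    [3 * k * ln (V / eps)] suffices. Rounding costs at most one stage, which is
    absorbed in the constant because [k >= 1] and
    [ln (V / eps) >= ln 2 >= 1 / 2]. *)
Lemma geometric_decay (R : realType) (k V eps : R) :
  1 <= k -> 0 < eps -> 2 * eps <= V ->
  exists n : nat, [/\ (1 <= n)%N, (2 * n)%:R <= 10 * k * ln (V / eps) &
    forall m, (n <= m)%N -> (1 - (3 * k)^-1) ^+ m * V <= eps].
Proof.
move=> k1 eps0 epsV; set l := ln _.
have V0 : 0 < V by lra.
have k0 : 0 < k by lra.
have Ve0 : 0 < V / eps by rewrite divr_gt0.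
have l12 : 1 / 2 <= l.
  rewrite -ler_expR lnK ?posrE//; apply: le_trans (_ : 2 <= _); last first.
    by rewrite ler_pdivlMr.
  (* expR (1 / 2) <= 2 is the inverse of 1 - 1 / 2 <= expR (- (1 / 2)). *)
  have := expR_ge1Dx (- (1 / 2) : R); rewrite expRN => H.
  have e0 := expR_gt0 (1 / 2 : R).
  have : (1 / 2) * expR (1 / 2) <= 1 :> R.
    rewrite -[leRHS](mulVf (lt0r_neq0 e0)) ler_pM2r//; lra.
  lra.
have kl0 : 0 <= 3 * k * l by rewrite !mulr_ge0//; lra.
have [n1 n2] := andP (truncn_itv kl0).
exists (Num.truncn (3 * k * l)).+1; split => // [|m nm].
  rewrite natrM -natr1; nra.
have r0 : 0 <= 1 - (3 * k)^-1.
  by rewrite subr_ge0 invf_le1 ?mulr_gt0//; lra.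
have -> : eps = expR (- l) * V.
  by rewrite expRN lnK ?posrE// invf_div divfK// gt_eqF.
rewrite ler_pM2r//.
have : (1 - (3 * k)^-1) ^+ m <= expR (- (3 * k)^-1) ^+ m.
  by rewrite lerXn2r ?nnegrE ?expR_ge0//; exact: expR_ge1Dx.
move=> /le_trans; apply; rewrite -expRM_natl ler_expR -mulr_natl mulrN lerN2.
rewrite ler_pdivlMr ?mulr_gt0// mulrC mulr1.
by apply: le_trans (ltW n2) _; rewrite ler_nat.
Qed.

Theorem theorem4p6 (R : realType) :
  (forall (dx dy : nat) (mu L : R) (f : 'rV[R]_dx * 'rV[R]_dy -> R)
     (zstar : 'rV[R]_dx * 'rV[R]_dy),
     0 < mu -> mu <= L ->
     smooth L f -> strongly_convex_concave mu f -> saddle_point f zstar ->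
     forall (T : nat) (h : R) (z0 : 'rV[R]_dx * 'rV[R]_dy),
     (1 <= T)%N -> 0 < h -> h <= 1 / (3 * L) ->
     forall (d : measure_display) (Omega : measurableType d)
       (P : probability Omega R) (alpha beta : nat -> Omega -> R),
     randomized_slingshot P T h alpha beta ->
     (expected_sq_error P f alpha beta z0 zstar (2 * T)
        <= ((1 - h * mu) ^+ T * enorm2 (z0 - zstar) ^+ 2)%:E)%E)
  /\
  (exists C : R, 0 < C /\
     forall (dx dy : nat) (mu L : R) (f : 'rV[R]_dx * 'rV[R]_dy -> R)
       (zstar : 'rV[R]_dx * 'rV[R]_dy),
     0 < mu -> mu <= L ->
     smooth L f -> strongly_convex_concave mu f -> saddle_point f zstar ->
     forall (z0 : 'rV[R]_dx * 'rV[R]_dy) (eps : R),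
     0 < eps -> eps <= 1 / 2 * enorm2 (z0 - zstar) ^+ 2 ->
     exists T0 : nat,
       [/\ (1 <= T0)%N,
           (2 * T0)%:R <= C * (L / mu) * ln (enorm2 (z0 - zstar) ^+ 2 / eps)
         & forall T : nat, (T0 <= T)%N ->
           forall (d : measure_display) (Omega : measurableType d)
             (P : probability Omega R) (alpha beta : nat -> Omega -> R),
           randomized_slingshot P T (1 / (3 * L)) alpha beta ->
           (expected_sq_error P f alpha beta z0 zstar (2 * T) <= eps%:E)%E]).
Proof.
split=> [dx dy mu L f zs mu0 muL sf scc sad T h z0 _ h0 hL d Omega P al be rs|].
  by have := expected_slingshot_error z0 mu0 muL h0 hL sf scc sad rs.
exists 10; split=> // dx dy mu L f zs mu0 muL sf scc sad z0 eps eps0 epsV.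
have L0 : 0 < L := lt_le_trans mu0 muL.
have k1 : 1 <= L / mu by rewrite ler_pdivlMr// mul1r.
have epsV2 : 2 * eps <= enorm2 (z0 - zs) ^+ 2 by lra.
have [n [n0 nk decay]] := geometric_decay k1 eps0 epsV2.
exists n; split=> // T nT d Omega P al be rs.
have h0 : 0 < 1 / (3 * L) by rewrite divr_gt0 ?mulr_gt0.
apply: le_trans (expected_slingshot_error z0 mu0 muL h0 (lexx _) sf scc sad rs) _.
rewrite lee_fin (_ : 1 - _ = 1 - (3 * (L / mu))^-1); first exact: decay.
by field; rewrite !gt_eqF.
Qed.
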